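(* Let $C_n$ be the cycle of length $n\geq 3$. Then $\chi_i^{c}(C_n)=4$ if $n$ is even, $\chi_i^{c}(C_n)=5$ if $n\geq 5$ is odd, and $\chi_i^{c}(C_3)=6$.
   Context: An incidence of a graph $G$ is a pair $(v,e)$ where $v$ is a vertex and $e$ an edge incident with $v$. For a vertex $w$, let $I(w)$ be the set of all incidences $(u,e)$ such that $e$ is incident with $w$. Two incidences conflict if both lie in $I(w)$ for some vertex $w$. A conflict-free incidence $k$-coloring assigns colors from a $k$-element set to the incidences so that conflicting incidences get distinct colors; $\chi^{c}_i(G)$ is the least such $k$. *)

(* Defs.v *)
From mathcomp Require Import all_boot.

Set Implicit Arguments.
Unset Strict Implicit.
Unset Printing Implicit Defensive.

Record sgraph := SGraph {
  vertex :> finType;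
  adj : rel vertex;
  adj_sym : symmetric adj;
  adj_irr : irreflexive adj
}.

Definition edges (G : sgraph) : {set {set G}} :=
  [set [set p.1; p.2] | p : G * G & adj p.1 p.2].

(* A type of its own rather than a set of pairs, so that a coloring has no
   values outside the incidences: an edgeless graph is colorable with 0 colors. *)
Definition incidence (G : sgraph) : finType :=
  {i : G * {set G} | (i.2 \in edges G) && (i.1 \in i.2)}.

(* The set I(w): i ranges over both incidences (u, e) of each edge e at w,
   not only over those with u = w. *)
Definition inc_at (G : sgraph) (w : G) : {set incidence G} :=
  [set i : incidence G | w \in (val i).2].

Definition conflict (G : sgraph) (i j : incidence G) : bool :=
  (i != j) && [exists w : G, (i \in inc_at w) && (j \in inc_at w)].

Definition conflict_free (G : sgraph) (k : nat)
    (c : {ffun incidence G -> 'I_k}) : bool :=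
  [forall i, forall j, conflict i j ==> (c i != c j)].

Definition cf_colorable (G : sgraph) (k : nat) : bool :=
  [exists c : {ffun incidence G -> 'I_k}, conflict_free c].

Lemma cf_colorable_exists (G : sgraph) : exists k, cf_colorable G k.
Proof.
exists #|incidence G|; apply/existsP.
exists [ffun i => enum_rank i]; apply/forallP => i; apply/forallP => j.
apply/implyP => /andP[neq_ij _]; rewrite !ffunE.
by rewrite (inj_eq enum_rank_inj).
Qed.

Definition chi_ic (G : sgraph) : nat := ex_minn (cf_colorable_exists G).

(* ordS is the cyclic successor x + 1 mod n; the conjunct x != y only
   matters for n = 1, where it excludes a loop. *)
Definition cycle_adj (n : nat) : rel 'I_n :=
  fun x y => (x != y) && ((y == ordS x) || (x == ordS y)).

Lemma cycle_adj_sym n : symmetric (@cycle_adj n).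
Proof. by move=> x y; rewrite /cycle_adj eq_sym orbC. Qed.

Lemma cycle_adj_irr n : irreflexive (@cycle_adj n).
Proof. by move=> x; rewrite /cycle_adj eqxx. Qed.

Definition cycle_graph (n : nat) : sgraph :=
  SGraph (@cycle_adj_sym n) (@cycle_adj_irr n).

(* Main.v *)
Require Import Defs.
From mathcomp Require Import all_boot.

                                                                          
                                                                        
                                                                              
                                                                                 
                                                                               
                                                                            
                                                                             
                            

(** Each edge of the cycle carries two incidences, and distinct incidences conflict exactly when
    their edges are equal or consecutive. A conflict-free coloring thus gives each edge two distinct
    colors, with consecutive edges getting disjoint pairs ([cycle_colorableP], [cycle_color_pairs]).
    Lower bounds: two consecutive edges use 4 colors; with only 4, pairs alternate between a set and
    its complement, which cannot close up around an odd cycle; in a triangle all three pairs are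
    disjoint. Upper bounds: the edge [x] gets the colors [s x] and [s x + 1] modulo [k], where [s]
    moves by 2 up or down at each step ([cycle_colorable_of_starts]). *)

Lemma chi_ic_eq (G : sgraph) (k : nat) :
  cf_colorable G k -> (forall m, cf_colorable G m -> k <= m) -> chi_ic G = k.
Proof.
rewrite /chi_ic => col_k min_k; case: ex_minnP => m col_m min_m.
by apply/eqP; rewrite eqn_leq min_m ?min_k.
Qed.

Lemma disjoint_cardsU {T : finType} {A B : {set T}} :
  [disjoint A & B] -> #|A :|: B| = #|A| + #|B|.
Proof. by move=> dAB; apply/eqP; rewrite leq_card_setU. Qed.

Lemma val_iter_ordS (n d : nat) (x : 'I_n) :
  iter d (@ordS n) x = (x + d) %% n :> nat.
Proof.
elim: d => [|d IHd] /=; first by rewrite addn0 modn_small.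
by rewrite IHd -addn1 modnDml addn1 addnS.
Qed.

Lemma iter_ordS_neq (n d : nat) (x : 'I_n) :
  0 < d < n -> iter d (@ordS n) x != x.
Proof.
case/andP=> d_gt0 lt_dn; apply/eqP => /(congr1 val) /=; rewrite val_iter_ordS.
move=> /eqP; rewrite -[X in _ == X](modn_small (ltn_ord x)).
rewrite -{2}[val x]addn0 eqn_modDl mod0n modn_small //.
by rewrite eqn0Ngt d_gt0.
Qed.

Section Cycle.

Variables (n : nat) (n_ge3 : 3 <= n).

Let ordS_neq (x : 'I_n) : ordS x != x.
Proof. by apply: (@iter_ordS_neq n 1); rewrite (ltn_trans _ n_ge3). Qed.

Let ordS2_neq (x : 'I_n) : ordS (ordS x) != x.
Proof. exact: (@iter_ordS_neq n 2). Qed.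

Definition cycle_edge (x : 'I_n) : {set cycle_graph n} := [set x; ordS x].

Lemma cycle_edgeP (e : {set cycle_graph n}) :
  reflect (exists x, e = cycle_edge x) (e \in edges (cycle_graph n)).
Proof.
apply: (iffP imsetP) => [[[x y] /= xy ->] | [x ->]].
  move: xy; rewrite inE /= /cycle_adj => /andP[_ /orP[] /eqP ->].
    by exists x.
  by exists y; rewrite /cycle_edge setUC.
exists (x, ordS x) => //.
by rewrite inE /= /cycle_adj eqxx eq_sym ordS_neq.
Qed.

(** This is where a length of at least 3 enters: on two vertices both indices would name the same
    edge. *)
Lemma cycle_edge_inj : injective cycle_edge.
Proof.
move=> x y exy.
have: x \in cycle_edge y by rewrite -exy !inE eqxx.
have: y \in cycle_edge x by rewrite exy !inE eqxx.
rewrite !inE => /orP[/eqP -> //|/eqP ->] /orP[/eqP //|].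
by rewrite eq_sym (negPf (ordS2_neq x)).
Qed.

(** Coordinates for incidences: [p.1] names the edge by its starting vertex, and [p.2] tells which
    of its two ends is meant. *)
Definition inc_end (p : 'I_n * bool) : 'I_n := if p.2 then ordS p.1 else p.1.

Lemma cycle_inc_subproof (p : 'I_n * bool) :
  (cycle_edge p.1 \in edges (cycle_graph n)) && (inc_end p \in cycle_edge p.1).
Proof.
apply/andP; split; first by apply/cycle_edgeP; exists p.1.
by rewrite !inE /inc_end; case: p.2; rewrite eqxx ?orbT.
Qed.

Definition cycle_inc (p : 'I_n * bool) : incidence (cycle_graph n) :=
  exist _ (inc_end p, cycle_edge p.1) (cycle_inc_subproof p).

Lemma cycle_inc_inj : injective cycle_inc.
Proof.
move=> [x b] [y c] /(congr1 val) /= [/[swap] /cycle_edge_inj <-].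
rewrite /inc_end /=; case: b c => [] [] // /eqP.
  by rewrite (negPf (ordS_neq x)).
by rewrite eq_sym (negPf (ordS_neq x)).
Qed.

Lemma cycle_inc_bij : bijective cycle_inc.
Proof.
suff surj i : i \in codom cycle_inc.
  exists (fun i => iinv (surj i)) => [p|i]; last exact: f_iinv.
  by apply: cycle_inc_inj; rewrite f_iinv.
case: i => [[u e] /= ue]; have /andP[/cycle_edgeP[x /= ex] /= ux] := ue.
have: u \in cycle_edge x by rewrite -ex.
rewrite !inE => /orP[] /eqP ux'; apply/codomP.
  by exists (x, false); apply: val_inj; rewrite /= ex ux'.
by exists (x, true); apply: val_inj; rewrite /= ex ux'.
Qed.

(** Only the edges matter, since [inc_at] ignores which end is chosen: a common vertex is the start
    or the end of each edge, which gives the cases below. *)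
Lemma cycle_conflict (p q : 'I_n * bool) :
  conflict (cycle_inc p) (cycle_inc q) =
  (p != q) && [|| p.1 == q.1, q.1 == ordS p.1 | p.1 == ordS q.1].
Proof.
rewrite /conflict (inj_eq cycle_inc_inj); congr (_ && _).
apply/existsP/idP => [[w] | ].
  rewrite !inE /= => /andP[/orP[] /eqP -> /orP[]].
  - by move=> ->.
  - by move=> ->; rewrite !orbT.
  - by rewrite eq_sym => ->; rewrite orbT.
  - by rewrite (inj_eq (@ordS_inj n)) => ->.
case/or3P => /eqP pq.
- by exists p.1; rewrite !inE /= pq eqxx.
- by exists q.1; rewrite !inE /= pq eqxx orbT.
- by exists p.1; rewrite !inE /= pq eqxx orbT.
Qed.

Lemma cycle_colorableP (k : nat) :
  reflect (exists f : 'I_n -> bool -> 'I_k,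
             (forall x, f x false != f x true)
             /\ (forall x b c, f x b != f (ordS x) c))
          (cf_colorable (cycle_graph n) k).
Proof.
apply: (iffP existsP) => [[c /forallP col] | [f [f_edge f_next]]].
  have colE p q : conflict (cycle_inc p) (cycle_inc q) ->
      c (cycle_inc p) != c (cycle_inc q).
    by move=> pq; have /forallP/(_ (cycle_inc q))/implyP := col (cycle_inc p); exact.
  exists (fun x b => c (cycle_inc (x, b))); split=> [x | x b d]; apply: colE.
    by rewrite cycle_conflict /= eqxx xpair_eqE eqxx.
  by rewrite cycle_conflict /= eqxx orbT xpair_eqE eq_sym (negPf (ordS_neq x)).
have [g gK Kg] := cycle_inc_bij.
exists [ffun i => f (g i).1 (g i).2].
apply/forallP => i; apply/forallP => j; apply/implyP; rewrite !ffunE.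
rewrite -[i in conflict i _]Kg -[j in conflict _ j]Kg cycle_conflict.
case: (g i) (g j) => [x b] [y d] /= /andP[neq /or3P[] /eqP xy].
- move: neq; rewrite xy xpair_eqE eqxx /=; case: b d => [] [] // _.
  by rewrite eq_sym.
- by rewrite xy.
- by rewrite xy eq_sym.
Qed.

(** The order of the two colors on an edge is forgotten; the lower bounds need only the pairs as
    sets. *)
Lemma cycle_color_pairs (k : nat) : cf_colorable (cycle_graph n) k ->
  exists A : 'I_n -> {set 'I_k},
    (forall x, #|A x| = 2) /\ (forall x, [disjoint A x & A (ordS x)]).
Proof.
case/cycle_colorableP => f [f_edge f_next].
exists (fun x => [set f x b | b : bool]); split=> x.
  rewrite card_imset ?card_bool // => -[] [] // /eqP.
    by rewrite eq_sym (negPf (f_edge x)).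
  by rewrite (negPf (f_edge x)).
apply/pred0P => a /=; apply/negP => /andP[/imsetP[b _ ->] /imsetP[c _ /eqP]].
by rewrite (negPf (f_next x b c)).
Qed.

Lemma cycle_colorable_ge4 (k : nat) : cf_colorable (cycle_graph n) k -> 4 <= k.
Proof.
case/cycle_color_pairs => A [A2 Adisj].
pose x : 'I_n := Ordinal (ltn_trans (ltn0Sn 1) n_ge3).
have := disjoint_cardsU (Adisj x); rewrite !A2 => AU.
by rewrite -[4]/(2 + 2) -AU -[k in _ <= k]card_ord max_card.
Qed.

Lemma odd_cycle_colorable_ge5 (k : nat) :
  odd n -> cf_colorable (cycle_graph n) k -> 5 <= k.
Proof.
move=> odd_n col; rewrite ltn_neqAle cycle_colorable_ge4 // andbT.
apply/eqP => k4; case/cycle_color_pairs: col => A [A2 Adisj].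
(* Disjoint 2-sets among 4 colors are complementary. *)
have AS x : A (ordS x) = ~: A x.
  apply/eqP; rewrite eqEcard -disjoints_subset disjoint_sym Adisj /=.
  by rewrite -(leq_add2l #|A x|) cardsC card_ord !A2 -k4.
have Aiter d x : A (iter d (@ordS n) x) = if odd d then ~: A x else A x.
  by elim: d => //= d IHd; rewrite AS IHd; case: (odd d); rewrite //= setCK.
pose x : 'I_n := Ordinal (ltn_trans (ltn0Sn 1) n_ge3).
(* After [n] steps, an odd number of complementations returns to the starting edge, so [A x] would
   equal its own complement. *)
have xn : iter n (@ordS n) x = x.
  by apply: val_inj; rewrite /= val_iter_ordS add0n modnn.
have := Adisj x; have := Aiter n x; rewrite xn odd_n AS => <-.
by rewrite -setI_eq0 setIid -cards_eq0 A2.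
Qed.

Lemma cycle_colorable_of_starts (k : nat) (s : 'I_n -> nat) :
  4 <= k ->
  (forall x, (s (ordS x) == s x + 2 %[mod k])
          || (s x == s (ordS x) + 2 %[mod k])) ->
  cf_colorable (cycle_graph n) k.
Proof.
move=> k_ge4 sS; have k_gt0 : 0 < k by apply: leq_trans k_ge4.
(* Relative to [u], the two blocks have offsets 0, 1 and 2, 3, which are distinct modulo [k] because
   [k] is at least 4. *)
have shift_neq (u v : nat) (b c : bool) :
    v == u + 2 %[mod k] -> u + b != v + c %[mod k].
  move=> /eqP uv; rewrite -(modnDml v) uv modnDml -addnA eqn_modDl.
  by rewrite !modn_small //; case: b; case: c; rewrite //= (leq_trans _ k_ge4).
apply/cycle_colorableP.
exists (fun x (b : bool) => Ordinal (ltn_pmod (s x + b) k_gt0)).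
split=> [x | x b c]; rewrite -val_eqE /=.
  by rewrite eqn_modDl !modn_small // (leq_trans _ k_ge4).
by case/orP: (sS x) => /shift_neq // ?; rewrite eq_sym.
Qed.

Lemma even_cycle_colorable : ~~ odd n -> cf_colorable (cycle_graph n) 4.
Proof.
(* The starts alternate between 0 and 2, and 2 + 2 is 0 modulo 4. *)
move=> even_n; apply: (@cycle_colorable_of_starts 4 (fun x => (odd x).*2)) => // x.
by rewrite /= odd_mod ?(negPf even_n) //=; case: (odd x).
Qed.

Lemma odd_cycle_colorable :
  odd n -> 5 <= n -> cf_colorable (cycle_graph n) 5.
Proof.
move=> odd_n n_ge5.
(* The starts 0, 2, 4, 6, 8 wind through all residues modulo 5 and absorb the odd parity; then 0 and
   8 alternate, as 8 + 2 is 0 modulo 5. *)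
pose s i := if i < 5 then i.*2 else if odd i then 0 else 8.
apply: (@cycle_colorable_of_starts 5 s) => // x.
rewrite /=; have := ltn_ord x; rewrite leq_eqVlt => /orP[/eqP xn | lt_xn].
  (* The closing step: the last index [n - 1] is even and at least 4, so its start is 8, next to the
     start 0 of the edge 0. *)
  rewrite xn modnn.
  have even_x : ~~ odd x by have := congr1 odd xn; rewrite odd_n /= => ->.
  have x_ge4 : 4 <= x by rewrite -ltnS xn.
  have -> : s x = 8; last by [].
  move: x_ge4 even_x; rewrite /s.
  by case: (nat_of_ord x) => [|[|[|[|[|m]]]]] //= _ /negPf ->.
rewrite (modn_small lt_xn) /s.
case: (nat_of_ord x) => [|[|[|[|[|m]]]]] //=.
by case: (odd m).
Qed.

End Cycle.

Lemma triangle_colorable : cf_colorable (cycle_graph 3) 6.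
Proof.
(* The starts 0, 2, 4 close up since 4 + 2 is 0 modulo 6. *)
apply: (@cycle_colorable_of_starts 3 _ 6 (fun x => x.*2)) => //.
by case=> [[|[|[|]]]].
Qed.

Lemma triangle_colorable_ge6 (k : nat) :
  cf_colorable (cycle_graph 3) k -> 6 <= k.
Proof.
case/cycle_color_pairs => // A [A2 Adisj].
pose x : 'I_3 := ord0.
have Sx3 : ordS (ordS (ordS x)) = x by apply: val_inj.
(* With three edges, the last is also consecutive to the edge [x], so all three pairs are
   disjoint. *)
have := Adisj (ordS (ordS x)); rewrite Sx3 => A20.
have A01_2 : [disjoint A x :|: A (ordS x) & A (ordS (ordS x))].
  rewrite disjoints_subset subUset -!disjoints_subset Adisj andbT.
  by rewrite disjoint_sym.
have := disjoint_cardsU A01_2.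
rewrite (disjoint_cardsU (Adisj x)) !A2 => AU.
by rewrite -[6]/(2 + 2 + 2) -AU -[k in _ <= k]card_ord max_card.
Qed.

Theorem theorem2p5 (n : nat) (hn : 3 <= n) :
  [/\ ~~ odd n -> chi_ic (cycle_graph n) = 4,
      odd n -> 5 <= n -> chi_ic (cycle_graph n) = 5
    & chi_ic (cycle_graph 3) = 6].
Proof.
split=> [even_n | odd_n n_ge5 |]; apply: chi_ic_eq.
- exact: even_cycle_colorable.
- by move=> m; apply: cycle_colorable_ge4.
- exact: odd_cycle_colorable.
- by move=> m; apply: odd_cycle_colorable_ge5.
- exact: triangle_colorable.
- exact: triangle_colorable_ge6.
Qed.
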